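(* The canonical basis of $\mathcal{S}^\imath_{m|n,d}$ relative to its standard basis $\{[A]\mid A\in\Xi^\imath_{m|n,d}\}$ — that is, the unique $\mathcal{A}$-basis of $\mathcal{S}^\imath_{m|n,d}$ indexed by $\Xi^\imath_{m|n,d}$ whose $A$-th element is bar invariant and lies in $[A]+\sum_{B\in\Xi^\imath_{m|n,d},\,B<_{\mathrm{alg}}A}v^{-1}\mathbb{Z}[v^{-1}][B]$ — is $\{\{A\}\mid A\in\Xi^\imath_{m|n,d}\}$, where $\{\{A\}\mid A\in\Xi_{m|n,d}\}$ is the canonical basis of $\mathcal{S}^\jmath_{m|n,d}$ relative to $\{[A]\mid A\in\Xi_{m|n,d}\}$.
   Context: Fix integers $d\ge1$, $m,n\ge0$. Put $\mathcal{A}=\mathbb{Z}[v,v^{-1}]$, $q=v^2$. $W$ is the group of permutations $w$ of $\{-d,\dots,d\}$ with $w(-i)=-w(i)$, with Coxeter generators $s_0=(-1,1)$, $s_i=(i,i+1)(-i,-i-1)$ ($1\le i<d$), length $\ell$. $\mathcal{H}$ is the Hecke algebra: free over $\mathcal{A}$ with basis $\{T_w\}_{w\in W}$, $T_wT_{w'}=T_{ww'}$ if $\ell(ww')=\ell(w)+\ell(w')$, $(T_{s_i}+1)(T_{s_i}-q)=0$. $\mathbb{I}=\{-m-n,\dots,m+n\}$ with parity $\widehat i=0$ if $|i|\le m$, $\widehat i=1$ if $|i|>m$. $\Lambda(m|n,d)=\{\lambda=(\lambda_0,\dots,\lambda_m|\lambda_{m+1},\dots,\lambda_{m+n})\in\mathbb{N}^{m+n+1}:\sum\lambda_i=d\}$,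 $\widetilde\lambda_i=\lambda_0+\cdots+\lambda_i$. Put $R_0^\lambda=\{-\lambda_0,\dots,\lambda_0\}$, $R_i^\lambda=\{\widetilde\lambda_{i-1}+1,\dots,\widetilde\lambda_i\}$ for $1\le i\le m+n$, $R_{-i}^\lambda=-R_i^\lambda$. $W_\lambda$ is generated by $\{s_0,\dots,s_{d-1}\}\setminus\{s_{\widetilde\lambda_0},\dots,s_{\widetilde\lambda_{m+n-1}}\}$; $W_{\lambda^{(0)}}$ (resp. $W_{\lambda^{(1)}}$) is generated by those $s_i\in W_\lambda$ with $i<\widetilde\lambda_m$ (resp. $i>\widetilde\lambda_m$); $W_\lambda=W_{\lambda^{(0)}}\times W_{\lambda^{(1)}}$ and $w\in W_\lambda$ is written uniquely $w=w^{(0)}w^{(1)}$, $w^{(i)}\in W_{\lambda^{(i)}}$. $[\mathrm{xy}]_\lambda=\sum_{w\in W_\lambda}(-q)^{-\ell(w^{(1)})}T_w$. $\mathcal{D}_{\lambda\mu}$ = shortest $(W_\lambda,W_\mu)$-double coset representatives; $\mathcal{D}^\circ_{\lambda\mu}=\{g\in\mathcal{D}_{\lambda\mu}: g^{-1}W_{\lambda^{(1)}}g\cap W_{\mu^{(0)}}=g^{-1}W_{\lambda^{(0)}}g\cap W_{\mu^{(1)}}=\{\mathbb 1\}\}$. $\Xi_{m|n,d}$ is the set of matrices $A=(a_{ij})_{i,j\in\mathbb{I}}$ over $\mathbb{N}$ with $\sum a_{ij}=2d+1$, $a_{ij}=a_{-i,-j}$, and $a_{ij}\in\{0,1\}$ whenever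 $\widehat i\ne\widehat j$. The map $\kappa(\lambda,g,\mu)=(|R_i^\lambda\cap gR_j^\mu|)_{i,j\in\mathbb{I}}$ is a bijection from triples with $\lambda,\mu\in\Lambda(m|n,d)$, $g\in\mathcal{D}^\circ_{\lambda\mu}$ onto $\Xi_{m|n,d}$; if $A=\kappa(\lambda,g,\mu)$ put $\mathrm{row}(A)=\lambda$, $\mathrm{col}(A)=\mu$. $\mathcal{S}^\jmath_{m|n,d}=\mathrm{End}_{\mathcal{H}}\big(\bigoplus_{\lambda\in\Lambda(m|n,d)}[\mathrm{xy}]_\lambda\mathcal{H}\big)$ (right modules). For $A=\kappa(\mu,g,\nu)\in\Xi_{m|n,d}$, let $W_\delta=g^{-1}W_\mu g\cap W_\nu$, $\mathcal{D}_\delta\cap W_\nu$ the shortest representatives of the right cosets $W_\delta\backslash W_\nu$, and let $e_A\in\mathcal{S}^\jmath_{m|n,d}$ be the right $\mathcal{H}$-linear map that is zero on $[\mathrm{xy}]_\lambda\mathcal{H}$ for $\lambda\neq\nu$ and sends $[\mathrm{xy}]_\nu\mapsto[\mathrm{xy}]_\mu T_g\sum_{w\in\mathcal{D}_\delta\cap W_\nu}(-q)^{-\ell(w^{(1)})}T_w$ (here $w=w^{(0)}w^{(1)}$, $w^{(i)}\in W_{\nu^{(i)}}$). The $e_A$ form an $\mathcal{A}$-basis of $\mathcal{S}^\jmath_{m|n,d}$. Let $I_{\mathfrak c}=(\{0\}\times[0..m+n])\sqcup([1..m+n]\times\mathbb{I})$, $a^\natural_{00}=\frac{a_{00}-1}2$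 and $a^\natural_{ij}=a_{ij}$ for $(i,j)\ne(0,0)$. Put $\ell(A)=\frac12\sum_{(i,j)\in I_{\mathfrak c}}\big(\sum_{k<i,\,l>j}+\sum_{k>i,\,l<j}\big)a^\natural_{ij}a_{kl}$, $\ell^\circ(A)=\frac12\sum_{(i,j)\in I_{\mathfrak c}}\sum_{l\ne j}(-1)^{\widehat i}a^\natural_{ij}a_{il}$, $\widehat\ell(A)=\ell(A)+\ell^\circ(A)$. Let $A^\circ$ be the matrix with $a^\circ_{ij}=a_{ij}$ if $\widehat i=1$, $a^\circ_{00}=1$, and $a^\circ_{ij}=0$ otherwise; $\widehat A=\ell(A^\circ)$. Set $[A]=(-1)^{\widehat A}v^{-\widehat\ell(A)}e_A$. Bar involution on $\mathcal{H}$: the ring involution with $\overline v=v^{-1}$, $\overline{T_w}=T_{w^{-1}}^{-1}$. Bar involution on $\mathcal{S}^\jmath_{m|n,d}$: for $f\in\mathrm{Hom}_{\mathcal{H}}([\mathrm{xy}]_\lambda\mathcal{H},[\mathrm{xy}]_\mu\mathcal{H})$, $\overline f$ is the $\mathcal{H}$-linear map sending $[\mathrm{xy}]_\lambda$ to $\overline{f(\overline{[\mathrm{xy}]_\lambda})}$, extended additively. Partial order: with $\sigma_{ij}(A)=\sum_{x\le i,\,y\ge j}a_{xy}$, $A\le_{\mathrm{alg}}B$ iff $\mathrm{row}(A)=\mathrm{row}(B)$, $\mathrm{col}(A)=\mathrm{col}(B)$ and $\sigma_{ij}(A)\le\sigma_{ij}(B)$ for all $i<j$; $<_{\mathrm{alg}}$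 is the strict version. The canonical basis $\{\{A\}\mid A\in\Xi_{m|n,d}\}$ of $\mathcal{S}^\jmath_{m|n,d}$ is the unique basis with $\overline{\{A\}}=\{A\}\in[A]+\sum_{B<_{\mathrm{alg}}A}v^{-1}\mathbb{Z}[v^{-1}][B]$. The variant: $\Lambda^\imath(m|n,d)=\{\lambda\in\Lambda(m|n,d):\lambda_0=0\}$; $\Xi^\imath_{m|n,d}=\{A\in\Xi_{m|n,d}:\mathrm{row}(A)_0=0=\mathrm{col}(A)_0\}$; $\mathcal{S}^\imath_{m|n,d}=\mathrm{End}_{\mathcal{H}}\big(\bigoplus_{\lambda\in\Lambda^\imath(m|n,d)}[\mathrm{xy}]_\lambda\mathcal{H}\big)\subset\mathcal{S}^\jmath_{m|n,d}$, with bar involution defined in the same way (it is the restriction of that of $\mathcal{S}^\jmath_{m|n,d}$). *)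

(* Defs.v *)
From HB Require Import structures.
From mathcomp Require Import all_boot all_order all_fingroup all_algebra.
From mathcomp Require Import gproduct.
From mathcomp Require Import boolp.
Set Implicit Arguments.
Unset Strict Implicit.
Unset Printing Implicit Defensive.
Import GRing.Theory.
Local Open Scope ring_scope.

(** [Z[v, v^{-1}]] is realised as the subring of [Q(v)] of the fractions
    [p / v^k], with [p] in [Z[v]]. *)
Definition ratfun : fieldType := {fraction {poly int}}.
Definition ratfun_of (p : {poly int}) : ratfun := tofrac p.
HB.instance Definition _ := GRing.RMorphism.copy ratfun_of (@tofrac {poly int}).
Definition fv : ratfun := ratfun_of 'X.

Lemma fv_neq0 : fv != 0.
Proof. by rewrite /fv /ratfun_of tofrac_eq0 polyX_eq0. Qed.

Definition laurent_pred : {pred ratfun} :=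
  fun x => `[< exists (p : {poly int}) (k : nat), x = ratfun_of p / fv ^+ k >].

Lemma laurent_subring : subring_closed laurent_pred.
Proof.
have v0 k : fv ^+ k != 0 by rewrite expf_neq0 ?fv_neq0.
split.
- by apply/asboolP; exists 1, 0; rewrite rmorph1 divr1.
- move=> x y /asboolP [p [k ->]] /asboolP [r [l ->]]; apply/asboolP.
  exists (p * 'X^l - r * 'X^k), (k + l)%N.
  rewrite rmorphB !rmorphM !rmorphXn /= -/fv exprD.
  have sub_div (K : fieldType) (a b c e : K) :
    c != 0 -> e != 0 -> a / c - b / e = (a * e - b * c) / (c * e).
    by move=> c0 e0; rewrite -[in LHS]mulNr addf_div // mulNr.
  exact: sub_div.
- move=> x y /asboolP [p [k ->]] /asboolP [r [l ->]]; apply/asboolP.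
  by exists (p * r), (k + l)%N; rewrite rmorphM exprD invfM mulrACA.
Qed.
HB.instance Definition _ :=
  GRing.isSubringClosed.Build ratfun laurent_pred laurent_subring.

Record laurent := Laurent { lval : ratfun; _ : lval \in laurent_pred }.
HB.instance Definition _ := [isSub for lval].
HB.instance Definition _ := [Choice of laurent by <:].
HB.instance Definition _ := [SubChoice_isSubComNzRing of laurent by <:].

Lemma laurent_exp (k : int) : fv ^ k \in laurent_pred.
Proof.
apply/asboolP; case: k => k.
- by exists 'X^k, 0; rewrite divr1 rmorphXn.
- by exists 1, k.+1; rewrite rmorph1 div1r.
Qed.

Definition vpow (k : int) : laurent := Laurent (laurent_exp k).

Notation q := (vpow 2).

(** [(-q)^{-1} = - v^{-2}]. *)
Notation mq_inv := (- vpow (- 2%:Z)).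

(** [x] lies in [v^{-1} Z[v^{-1}]]. *)
Definition in_vinvZvinv (x : laurent) : Prop :=
  exists p : {poly int}, x = vpow (-1) * (map_poly intr p).[vpow (-1)].

(** The interval [{-N, ..., N}] is the ordinal type ['I_(2N+1)] shifted by [N];
    the order of ordinals is the order of integers and [rev_ord] is [i |-> -i]. *)
Notation sym N := 'I_(N.*2).+1.

Definition ival (N : nat) (i : sym N) : int := i%:Z - N%:Z.

Section TypeB.
Variable d : nat.

Record signed_perm := SignedPerm {
  sp_perm :> {perm sym d};
  _ : [forall x, sp_perm (rev_ord x) == rev_ord (sp_perm x)] }.
HB.instance Definition _ := [isSub for sp_perm].
HB.instance Definition _ := [Finite of signed_perm by <:].

Lemma sp_rev (w : signed_perm) x : w (rev_ord x) = rev_ord (w x).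
Proof. by case: w => w /= /forallP /(_ x) /eqP. Qed.

Lemma sp_one_subproof :
  [forall x, (1%g : {perm sym d}) (rev_ord x) == rev_ord ((1%g : {perm sym d}) x)].
Proof. by apply/forallP => x; rewrite !perm1. Qed.
Definition sp_one := SignedPerm sp_one_subproof.

Lemma sp_mul_subproof (w w' : signed_perm) :
  [forall x, (sp_perm w' * sp_perm w)%g (rev_ord x) == rev_ord ((sp_perm w' * sp_perm w)%g x)].
Proof. by apply/forallP => x; rewrite !permM !sp_rev. Qed.
(** Products of [{perm _}] read from left to right; the group law on signed
    permutations is the composition of maps, [(w w')(x) = w(w'(x))]. *)
Definition sp_mul (w w' : signed_perm) := SignedPerm (sp_mul_subproof w w').

Lemma sp_mulE (w w' : signed_perm) x : sp_mul w w' x = w (w' x).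
Proof. by rewrite /= permM. Qed.

Lemma sp_inv_subproof (w : signed_perm) :
  [forall x, (sp_perm w)^-1%g (rev_ord x) == rev_ord ((sp_perm w)^-1%g x)].
Proof.
apply/forallP => x; apply/eqP; apply: (@perm_inj _ w).
by rewrite sp_rev !permKV.
Qed.
Definition sp_inv (w : signed_perm) := SignedPerm (sp_inv_subproof w).

Lemma sp_mulA : associative sp_mul.
Proof. by move=> w1 w2 w3; apply: val_inj; rewrite /= mulgA. Qed.
Lemma sp_mul1 : left_id sp_one sp_mul.
Proof. by move=> w; apply: val_inj; rewrite /= mulg1. Qed.
Lemma sp_mulV : left_inverse sp_one sp_inv sp_mul.
Proof. by move=> w; apply: val_inj; rewrite /= mulgV. Qed.
HB.instance Definition _ := Finite_isGroup.Build signed_perm sp_mulA sp_mul1 sp_mulV.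

(** [s_0 = (-1, 1)] and [s_i = (i, i+1)(-i, -i-1)]. *)
Definition simple_perm (i : 'I_d) : {perm sym d} :=
  if i == 0 :> nat then tperm (inord (d - 1)) (inord (d + 1))
  else (tperm (inord (d + i)) (inord (d + i.+1))
        * tperm (inord (d - i)) (inord (d - i.+1)))%g.

Lemma simple_subproof (i : 'I_d) :
  [forall x, simple_perm i (rev_ord x) == rev_ord (simple_perm i x)].
Proof.
have lt_id := ltn_ord i.
have revD k : (k <= d)%N -> rev_ord (inord (d + k)) = inord (d - k) :> sym d.
  move=> kd; apply: val_inj; rewrite /= !inordK ?ltnS -?addnn ?leq_add2l //.
    by rewrite subSS subnDl.
  by rewrite (leq_trans (leq_subr _ _)) ?leq_addr.
have revB k : (k <= d)%N -> rev_ord (inord (d - k)) = inord (d + k) :> sym d.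
  by move=> kd; rewrite -revD // rev_ordK.
apply/forallP => x; apply/eqP; rewrite /simple_perm.
case: ifP => [_ | i_neq0].
  rewrite (inj_tperm _ _ _ rev_ord_inj) revB ?revD ?(leq_ltn_trans _ lt_id) //.
  by rewrite tpermC.
rewrite !permM !(inj_tperm _ _ _ rev_ord_inj) !revB ?revD ?(ltnW lt_id) //.
set a := inord (d + i); set b := inord (d + i.+1).
set a' := inord (d - i); set b' := inord (d - i.+1).
have neqDB k l : (0 < k <= d)%N -> (0 < l <= d)%N ->
    inord (d - k) != inord (d + l) :> sym d.
  move=> /andP[k0 kd] /andP[l0 ld]; apply/eqP => /(congr1 val).
  rewrite /= !inordK ?ltnS -?addnn ?leq_add2l //; last first.
    by rewrite (leq_trans (leq_subr _ _)) ?leq_addr.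
  by move=> /eqP; rewrite eq_sym gtn_eqF // (leq_ltn_trans (leq_subr _ _)) // -addn1 leq_add2l.
have i_gt0 : (0 < i)%N by rewrite lt0n i_neq0.
have comm : (tperm a' b' * tperm a b = tperm a b * tperm a' b')%g.
  by rewrite conjgC tpermJ !tpermD // eq_sym neqDB ?i_gt0 ?(ltnW lt_id).
by rewrite -!permM comm.
Qed.
Definition simple (i : 'I_d) : signed_perm := SignedPerm (simple_subproof i).

(** The least number of factors in an expression of [w] as a product of simple
    reflections; it is always less than the order of the group. *)
Definition len (w : signed_perm) : nat :=
  find (fun k => [exists t : k.-tuple 'I_d, w == (\prod_(i <- t) simple i)%g])
       (iota 0 #|{: signed_perm}|).

End TypeB.

Record hecke_algebra (d : nat) := HeckeAlgebra {
  hecke_sort :> algType laurent;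
  T : signed_perm d -> hecke_sort;
  T_basis : forall h : hecke_sort,
    exists! c : {ffun signed_perm d -> laurent}, h = \sum_w c w *: T w;
  T_mul : forall w w' : signed_perm d,
    len (w * w')%g = (len w + len w')%N -> T w * T w' = T (w * w')%g;
  T_quad : forall i : 'I_d,
    (T (simple i) + 1) * (T (simple i) - q%:A) = 0 }.
Arguments T {d _} _.

Definition is_hecke_bar (d : nat) (H : hecke_algebra d) (bar : {rmorphism H -> H}) :=
  [/\ forall h, bar (bar h) = h,
      bar ((vpow 1)%:A) = (vpow (-1))%:A
    & forall w : signed_perm d,
        bar (T w) * T w^-1%g = 1 /\ T w^-1%g * bar (T w) = 1].

Section Combinatorics.
Variables m n d : nat.

Definition odd_index (i : sym (m + n)) : bool := (m < `|ival i|)%N.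

Record composition := Composition {
  parts :> {ffun 'I_(m + n).+1 -> 'I_d.+1};
  _ : (\sum_i parts i)%N == d }.
HB.instance Definition _ := [isSub for parts].
HB.instance Definition _ := [Finite of composition by <:].

Definition psum (la : composition) (k : nat) : nat :=
  (\sum_(i < (m + n).+1 | i <= k) la i)%N.

Definition pos_block (la : composition) (k : nat) : {set sym d} :=
  [set x : sym d | ((psum la k.-1)%:Z < ival x) && (ival x <= (psum la k)%:Z)].

Definition block (la : composition) (i : sym (m + n)) : {set sym d} :=
  if ival i == 0 then [set x : sym d | (`|ival x| <= la ord0)%N]
  else if 0 < ival i then pos_block la `|ival i|%N
  else [set rev_ord x | x in pos_block la `|ival i|%N].

Definition par_gens (la : composition) : {set 'I_d} :=
  [set i : 'I_d | [forall k : 'I_(m + n), psum la k != i]].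

Definition Wp (la : composition) : {group signed_perm d} :=
  <<[set simple i | i in par_gens la]>>%G.
Definition Wp0 (la : composition) : {group signed_perm d} :=
  <<[set simple i | i in [set i in par_gens la | (i < psum la m)%N]]>>%G.
Definition Wp1 (la : composition) : {group signed_perm d} :=
  <<[set simple i | i in [set i in par_gens la | (psum la m < i)%N]]>>%G.

(** [w^{(1)}] in the decomposition [w = w^{(0)} w^{(1)}]. *)
Definition comp1 (la : composition) (w : signed_perm d) : signed_perm d :=
  remgr (Wp0 la) (Wp1 la) w.

Definition Dmin (la mu : composition) : {set signed_perm d} :=
  [set g | [forall x in (Wp la :* g * Wp mu)%g, (len g <= len x)%N]].

Definition Dcirc (la mu : composition) : {set signed_perm d} :=
  [set g in Dmin la mu | ((Wp1 la :^ g) :&: Wp0 mu == 1)%g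
                         && ((Wp0 la :^ g) :&: Wp1 mu == 1)%g].

(** The entries add up to [2d+1], so the bound built in the type of entries is
    no restriction; it makes the set of matrices a [finType]. *)
Record Xi := XiMatrix {
  xi_mat :> 'M['I_(d.*2).+2]_((m + n).*2.+1);
  _ : [&& (\sum_i \sum_j xi_mat i j)%N == d.*2.+1,
          [forall i, forall j, xi_mat i j == xi_mat (rev_ord i) (rev_ord j)]
        & [forall i, forall j,
             (odd_index i != odd_index j) ==> (xi_mat i j <= 1)%N]] }.
HB.instance Definition _ := [isSub for xi_mat].
HB.instance Definition _ := [Finite of Xi by <:].

Definition kappa (la : composition) (g : signed_perm d) (mu : composition)
    (i j : sym (m + n)) : nat :=
  #|block la i :&: [set g x | x in block mu j]|.

Lemma composition0_subproof :
  (\sum_i [ffun i : 'I_(m + n).+1 => if i == 0 :> nat then ord_max else ord0 : 'I_d.+1] i)%N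
  == d.
Proof.
rewrite (bigD1 ord0) //= ffunE eqxx big1 ?addn0 // => i i_neq0.
by rewrite ffunE ifN.
Qed.
Definition composition0 : composition := Composition composition0_subproof.

(** The triple [(la, g, mu)] with [A = kappa la g mu]; the default value is never
    used, as [kappa] is a bijection onto [Xi]. *)
Definition kappa_inv (A : Xi) : composition * signed_perm d * composition :=
  odflt (composition0, 1%g, composition0)
    [pick t : composition * signed_perm d * composition |
       (t.1.2 \in Dcirc t.1.1 t.2)
       && [forall i, forall j, A i j == kappa t.1.1 t.1.2 t.2 i j :> nat]].

Definition xi_row (A : Xi) : composition := (kappa_inv A).1.1.
Definition xi_rep (A : Xi) : signed_perm d := (kappa_inv A).1.2.
Definition xi_col (A : Xi) : composition := (kappa_inv A).2.

Definition Ic (i j : sym (m + n)) : bool :=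
  ((ival i == 0) && (0 <= ival j)) || (0 < ival i).

Definition natural (a : sym (m + n) -> sym (m + n) -> nat) (i j : sym (m + n)) : nat :=
  if (ival i == 0) && (ival j == 0) then (a i j).-1./2 else a i j.

(** The halves below are exact on the matrices they are applied to. *)
Definition ell (a : sym (m + n) -> sym (m + n) -> nat) : nat :=
  (\sum_i \sum_(j | Ic i j)
     (\sum_(k : sym (m + n) | (k < i)%N) \sum_(l : sym (m + n) | (j < l)%N)
         natural a i j * a k l
      + \sum_(k : sym (m + n) | (i < k)%N) \sum_(l : sym (m + n) | (l < j)%N)
         natural a i j * a k l))%N./2.

Definition ell_circ (a : sym (m + n) -> sym (m + n) -> nat) : int :=
  ((\sum_i \sum_(j | Ic i j) \sum_(l | l != j)
      (-1) ^+ odd_index i * (natural a i j)%:Z * (a i l)%:Z) %/ 2)%Z.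

Definition ell_hat (A : Xi) : int :=
  (ell (fun i j => A i j))%:Z + ell_circ (fun i j => A i j).

Definition circ (A : Xi) (i j : sym (m + n)) : nat :=
  if odd_index i then (A i j : nat) else ((ival i == 0) && (ival j == 0) : nat).

Definition xi_hat (A : Xi) : nat := ell (circ A).

Definition sigma (A : Xi) (i j : sym (m + n)) : nat :=
  (\sum_(x : sym (m + n) | x <= i) \sum_(y : sym (m + n) | j <= y) A x y)%N.

Definition le_alg (A B : Xi) : bool :=
  [&& xi_row A == xi_row B, xi_col A == xi_col B
    & [forall i : sym (m + n), forall j : sym (m + n),
         (i < j)%N ==> (sigma A i j <= sigma B i j)%N]].

Definition lt_alg (A B : Xi) : bool := le_alg A B && (A != B).

Definition all_compositions : {set composition} := [set: composition].
Definition icompositions : {set composition} := [set la : composition | la ord0 == 0 :> nat].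

(** The matrices labelling the bases of the endomorphism algebra of
    [\bigoplus_(la in P) [xy]_la H]. *)
Definition Xi_on (P : {set composition}) : {set Xi} :=
  [set A | (xi_row A \in P) && (xi_col A \in P)].

End Combinatorics.

Section Schur.
Variables (m n d : nat) (H : hecke_algebra d).
Local Notation composition := (composition m n d).
Local Notation Xi := (Xi m n d).

Definition xy (la : composition) : H :=
  \sum_(w in Wp la) mq_inv ^+ len (comp1 la w) *: T w.

Section Module.
Variable P : {set composition}.

(** [\bigoplus_(la in P) [xy]_la H], inside the families of elements of [H]. *)
Definition xy_pred : {pred {ffun composition -> H}} :=
  fun x => `[< forall la, if la \in P then exists h, x la = xy la * h
                          else x la = 0 >].

Lemma xy_zmod_closed : zmod_closed xy_pred.
Proof.
split=> [|x y /asboolP Px /asboolP Py]; apply/asboolP => la.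
  by case: ifP => _; [exists 0; rewrite ffunE mulr0 | rewrite ffunE].
move: (Px la) (Py la); case: ifP => _; rewrite !ffunE.
  by move=> [h ->] [k ->]; exists (h - k); rewrite mulrBr.
by move=> -> ->; rewrite subr0.
Qed.
HB.instance Definition _ :=
  GRing.isZmodClosed.Build {ffun composition -> H} xy_pred xy_zmod_closed.

Record xy_module := XyModule { xy_val :> {ffun composition -> H}; _ : xy_val \in xy_pred }.
HB.instance Definition _ := [isSub for xy_val].
HB.instance Definition _ := [Choice of xy_module by <:].
HB.instance Definition _ := [SubChoice_isSubZmodule of xy_module by <:].

Lemma xy_ract_subproof (h : H) (x : xy_module) : [ffun la => x la * h] \in xy_pred.
Proof.
case: x => x /= /asboolP Px; apply/asboolP => la; move: (Px la).
case: ifP => _; rewrite ffunE; last by move=> ->; rewrite mul0r.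
by move=> [k ->]; exists (k * h); rewrite mulrA.
Qed.
Definition xy_ract (h : H^c) (x : xy_module) : xy_module :=
  XyModule (xy_ract_subproof h x).

Lemma xy_ractA (h k : H^c) (x : xy_module) : xy_ract h (xy_ract k x) = xy_ract (h * k) x.
Proof. by apply/val_inj/ffunP => la; rewrite !ffunE -mulrA. Qed.
Lemma xy_ract1 : left_id (1 : H^c) xy_ract.
Proof. by move=> x; apply/val_inj/ffunP => la; rewrite !ffunE mulr1. Qed.
Lemma xy_ractDr : right_distributive xy_ract +%R.
Proof. by move=> h x y; apply/val_inj/ffunP => la; rewrite !ffunE mulrDl. Qed.
Lemma xy_ractDl (x : xy_module) : {morph xy_ract^~ x : h k / h + k}.
Proof. by move=> h k; apply/val_inj/ffunP => la; rewrite !ffunE mulrDr. Qed.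

(** Right [H]-modules are left modules over the converse ring [H^c]:
    [h *: x] is the right action [x h]. *)
HB.instance Definition _ := GRing.Zmodule_isLmodule.Build H^c xy_module
  xy_ractA xy_ract1 xy_ractDr xy_ractDl.

Definition schur : Type := {linear xy_module -> xy_module}.
HB.instance Definition _ := gen_eqMixin schur.
HB.instance Definition _ := gen_choiceMixin schur.

Lemma schur_ext (f g : schur) : (forall x, f x = g x) -> f = g.
Proof.
case: f g => f [[Df] [Zf]] [g [[Dg] [Zg]]] /= fg.
have {}fg : f = g by apply/funext.
by subst g; rewrite (Prop_irrelevance Df Dg) (Prop_irrelevance Zf Zg).
Qed.

Definition schur_zero : schur := \0.
Definition schur_opp (f : schur) : schur := \- f.
Definition schur_add (f g : schur) : schur := f \+ g.

Lemma schur_addA : associative schur_add.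
Proof. by move=> f g h; apply: schur_ext => x /=; rewrite addrA. Qed.
Lemma schur_addC : commutative schur_add.
Proof. by move=> f g; apply: schur_ext => x /=; rewrite addrC. Qed.
Lemma schur_add0 : left_id schur_zero schur_add.
Proof. by move=> f; apply: schur_ext => x /=; rewrite add0r. Qed.
Lemma schur_addN : left_inverse schur_zero schur_opp schur_add.
Proof. by move=> f; apply: schur_ext => x /=; rewrite addNr. Qed.
HB.instance Definition _ := GRing.isZmodule.Build schur
  schur_addA schur_addC schur_add0 schur_addN.

(** The central scalar [a] acts by the right multiplication by [a 1_H]. *)
Definition schur_scale_fun (a : laurent) (f : schur) (x : xy_module) : xy_module :=
  (a%:A : H^c) *: f x.

Lemma schur_scale_subproof (a : laurent) (f : schur) : linear (schur_scale_fun a f).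
Proof.
move=> h x y; rewrite /schur_scale_fun linearP scalerDr !scalerA; congr (_ *: _ + _).
by rewrite /GRing.mul /= -scalerAl -scalerAr mul1r mulr1.
Qed.
HB.instance Definition _ a f :=
  GRing.isLinear.Build H^c xy_module xy_module *:%R (schur_scale_fun a f)
    (schur_scale_subproof a f).
Definition schur_scale (a : laurent) (f : schur) : schur := schur_scale_fun a f.

Lemma schur_scaleA a b f : schur_scale a (schur_scale b f) = schur_scale (a * b) f.
Proof.
apply: schur_ext => x; rewrite /= /schur_scale_fun scalerA; congr (_ *: _).
by rewrite [LHS]/GRing.mul /= -scalerAl mul1r scalerA mulrC.
Qed.
Lemma schur_scale1 : left_id 1 schur_scale.
Proof. by move=> f; apply: schur_ext => x; rewrite /= /schur_scale_fun !scale1r. Qed.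
Lemma schur_scaleDr : right_distributive schur_scale +%R.
Proof. by move=> a f g; apply: schur_ext => x; rewrite /= /schur_scale_fun scalerDr. Qed.
Lemma schur_scaleDl f : {morph schur_scale^~ f : a b / a + b}.
Proof.
by move=> a b; apply: schur_ext => x; rewrite /= /schur_scale_fun !scalerDl.
Qed.
HB.instance Definition _ := GRing.Zmodule_isLmodule.Build laurent schur
  schur_scaleA schur_scale1 schur_scaleDr schur_scaleDl.

Definition at_comp (la : composition) (h : H) : {ffun composition -> H} :=
  [ffun ka => if ka == la then h else 0].

(** [f] is [e_A]: it kills the summands other than that of [col A] and has the
    prescribed value on the generator [[xy]_nu]. *)
Definition is_std_map (A : Xi) (f : schur) : Prop :=
  let mu := xi_row A in let g := xi_rep A in let nu := xi_col A in
  let Wd := ((Wp mu :^ g) :&: Wp nu)%g in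
  let D := [set w in Wp nu | [forall x in (Wd :* w)%g, (len w <= len x)%N]] in
  (forall (la : composition) (x : xy_module),
     la != nu -> (forall ka, ka != la -> x ka = 0) -> f x = 0) /\
  exists2 x : xy_module, val x = at_comp nu (xy nu) &
    val (f x) = at_comp mu
      (xy mu * T g * \sum_(w in D) mq_inv ^+ len (comp1 nu w) *: T w).

(** [e_A], the default value being irrelevant as such a map exists. *)
Definition std_map (A : Xi) : schur :=
  if pselect (exists f, is_std_map A f) is left ex then projT1 (cid ex) else 0.

Definition std_elt (A : Xi) : schur :=
  ((-1) ^+ xi_hat A * vpow (- ell_hat A)) *: std_map A.

(** [g] is the bar conjugate of [f].  The value of [f] at the element bar [xy]_la
    of the summand [la] collects the components of [f] in all
    [Hom([xy]_la H, [xy]_mu H)], and bar acts on each of them. *)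
Definition is_schur_bar (bar : H -> H) (f g : schur) : Prop :=
  forall la : composition, la \in P ->
  exists x y : xy_module,
    [/\ val x = at_comp la (xy la),
        val y = at_comp la (bar (xy la))
      & forall mu, val (g x) mu = bar (val (f y) mu)].

Definition is_basis_on (X : {set Xi}) (C : Xi -> schur) : Prop :=
  (forall f : schur, exists c : Xi -> laurent, f = \sum_(A in X) c A *: C A) /\
  (forall c : Xi -> laurent,
     \sum_(A in X) c A *: C A = 0 -> forall A, A \in X -> c A = 0).

Definition is_canonical_basis (bar : H -> H) (C : Xi -> schur) : Prop :=
  is_basis_on (Xi_on P) C /\
  forall A, A \in Xi_on P ->
    is_schur_bar bar (C A) (C A) /\
    exists2 p : Xi -> laurent, forall B, in_vinvZvinv (p B) &
      C A = std_elt A + \sum_(B in Xi_on P | lt_alg B A) p B *: std_elt B.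

End Module.

Lemma xy_trunc_subproof (P Q : {set composition}) (x : xy_module P) :
  [ffun la => if la \in Q then x la else 0] \in xy_pred Q.
Proof.
case: x => x /= /asboolP Px; apply/asboolP => la; rewrite ffunE.
case laQ: (la \in Q) => //; move: (Px la); case laP: (la \in P) => //.
by move=> x0; exists 0; rewrite mulr0 -x0.
Qed.
Definition xy_trunc (P Q : {set composition}) (x : xy_module P) : xy_module Q :=
  XyModule (xy_trunc_subproof Q x).

Lemma xy_trunc_linear P Q : linear (@xy_trunc P Q).
Proof.
move=> h x y; apply/val_inj/ffunP => la; rewrite !ffunE.
by case: ifP => _ //; rewrite mul0r addr0.
Qed.
HB.instance Definition _ P Q :=
  GRing.isLinear.Build H^c (xy_module P) (xy_module Q) *:%R (@xy_trunc P Q)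
    (@xy_trunc_linear P Q).

(** Extension by zero, which embeds the endomorphisms of the partial direct sum
    into those of the full one. *)
Definition schur_incl (P : {set composition}) (f : schur P) : schur (all_compositions m n d) :=
  @xy_trunc P (all_compositions m n d) \o f \o @xy_trunc (all_compositions m n d) P.

End Schur.

(* Main.v *)
(** Write [S^i = e S^j e] with [e] the projection onto the summands with
    [la_0 = 0].  Every standard basis element [[A]] goes from the summand
    [col A] to the summand [row A], and [B < A] forces [row B = row A] and
    [col B = col A]; hence [f |-> e f e] fixes [{A}] when [row A] and [col A] lie
    in [Lambda^i] and kills it otherwise, which gives existence.

    For uniqueness, let [C] be a canonical basis,
    [[A] = \sum_E N_AE C_E] and [C_A = [A] + v^{-1} \sum_B y_AB [B]].  Linear
    independence gives [N = 1 - v^{-1} y N], so multiplying [N] by a power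
    [v^{-k}] that makes it a matrix over [Z[v^{-1}]] and lowering [k] step by step
    shows that [N] itself is over [Z[v^{-1}]].  The difference of two canonical
    basis elements is then [\sum_E r_E C_E] with [r_E] in [v^{-1} Z[v^{-1}]]; bar
    invariance makes [r_E] equal to its image under [v |-> v^{-1}], so [r_E = 0]. *)
From HB Require Import structures.
Require Import Defs.
From mathcomp Require Import all_boot all_order all_fingroup all_algebra.
From mathcomp Require Import boolp.
Set Implicit Arguments.
Unset Strict Implicit.
Unset Printing Implicit Defensive.
Import GRing.Theory.
Local Open Scope ring_scope.

(** * Laurent polynomials and the subring [Z[v^{-1}]] *)

Definition eval_int (x : laurent) (p : {poly int}) : laurent := (map_poly intr p).[x].
HB.instance Definition _ x :=
  GRing.RMorphism.copy (eval_int x) (horner_eval x \o map_poly intr).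

Lemma eval_intC x (c : int) : eval_int x c%:P = c%:~R.
Proof. by rewrite /eval_int map_polyC hornerC. Qed.

Lemma eval_intX x : eval_int x 'X = x.
Proof. by rewrite /eval_int map_polyX hornerX. Qed.

Lemma eval_intMXaddC x p (c : int) : eval_int x (p * 'X + c%:P) = eval_int x p * x + c%:~R.
Proof. by rewrite /eval_int rmorphD rmorphM /= map_polyX map_polyC hornerMXaddC. Qed.

Local Notation v := (vpow 1).
Local Notation vi := (vpow (-1)).

Lemma vpow_mulVr : vi * v = 1.
Proof. by apply: val_inj => /=; rewrite expr1z exprN1 mulVf ?fv_neq0. Qed.

Lemma vpow_expVr k : vi ^+ k * v ^+ k = 1.
Proof. by rewrite -exprMn vpow_mulVr expr1n. Qed.

Lemma lvalD x y : lval (x + y) = lval x + lval y.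
Proof. exact: (rmorphD val). Qed.

Lemma lvalM x y : lval (x * y) = lval x * lval y.
Proof. exact: (rmorphM val). Qed.

Lemma lval_int (c : int) : lval c%:~R = c%:~R.
Proof. exact: (rmorph_int val). Qed.

Lemma lval_eval_int p : lval (eval_int v p) = ratfun_of p.
Proof.
elim/poly_ind: p => [|p c IHp].
  by rewrite !rmorph0; exact: (rmorph0 val).
rewrite eval_intMXaddC lvalD lvalM IHp lval_int rmorphD rmorphM.
by rewrite -[X in X%:P]intz !rmorph_int.
Qed.

Lemma laurentE (a : laurent) : exists (k : nat) p, a = eval_int v p * vi ^+ k.
Proof.
have /asboolP [p [k Ea]] := valP a; exists k, p; apply: val_inj.
have lvalX l : lval (vi ^+ l) = fv ^- l.
  by rewrite -[LHS]/(val _) (rmorphXn val) /= exprN1 exprVn.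
by rewrite Ea -[RHS]/(lval _) lvalM lvalX lval_eval_int.
Qed.

(** The ring [Z[v^{-1}]], made a subring predicate so that integrality propagates through sums and
    products. *)
Definition vinv_poly : {pred laurent} := fun x => `[< exists p, x = eval_int vi p >].

Lemma vinv_poly_subring : subring_closed vinv_poly.
Proof.
split=> [|x y /asboolP[p ->] /asboolP[r ->]|x y /asboolP[p ->] /asboolP[r ->]].
- by apply/asboolP; exists 1; rewrite rmorph1.
- by apply/asboolP; exists (p - r); rewrite rmorphB.
- by apply/asboolP; exists (p * r); rewrite rmorphM.
Qed.
HB.instance Definition _ :=
  GRing.isSubringClosed.Build laurent vinv_poly vinv_poly_subring.

Lemma vinv_polyV : vi \in vinv_poly.
Proof. by apply/asboolP; exists 'X; rewrite eval_intX. Qed.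

Lemma in_vinvZvinvP x : in_vinvZvinv x <-> exists2 y, y \in vinv_poly & x = vi * y.
Proof.
split=> [[p ->]|[y /asboolP[p ->] ->]]; last by exists p.
by exists (eval_int vi p) => //; apply/asboolP; exists p.
Qed.

Lemma vinv_poly_bound (a : laurent) : exists k, vi ^+ k * a \in vinv_poly.
Proof.
have [l [p ->]] := laurentE a.
suff [k pk] : exists k, vi ^+ k * eval_int v p \in vinv_poly.
  by exists k; rewrite mulrA rpredM // rpredX // vinv_polyV.
(* Horner induction: each new factor [v] costs one more factor [v^{-1}]. *)
elim/poly_ind: p => [|p c [k IHp]]; first by exists 0; rewrite rmorph0 mulr0 rpred0.
exists k.+1; rewrite eval_intMXaddC mulrDr rpredD //.
  by rewrite exprSr -mulrA [vi * (_ * _)]mulrCA vpow_mulVr mulr1.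
by rewrite rpredM ?rpred_int // rpredX // vinv_polyV.
Qed.

Lemma vinv_poly_bounds (I : finType) (a : I -> laurent) :
  exists k, forall i, vi ^+ k * a i \in vinv_poly.
Proof.
have /choice [k ak] i := vinv_poly_bound (a i).
exists (\sum_i k i)%N => i; rewrite (bigD1 i) //= exprD mulrAC rpredM //.
by rewrite rpredX ?vinv_polyV.
Qed.

(** The left side has only negative powers of [v], the right side only positive ones. *)
Lemma eval_int_bar_fixed p : vi * eval_int vi p = v * eval_int v p -> p = 0.
Proof.
move=> Ep.
(* [rp] is the reversal of [p], of degree at most [N]; multiplying by [v^N] clears the negative
   powers and yields an identity of polynomials. *)
pose N := size p; pose rp := \sum_(i < N) p`_i *: 'X^(N - i).
have Erp : eval_int v rp = v ^+ N * eval_int vi p.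
  rewrite -[p in RHS]coefK poly_def !rmorph_sum mulr_sumr /=.
  apply: eq_bigr => i _; rewrite -!mul_polyC !rmorphM !rmorphXn /= !eval_intX.
  rewrite !eval_intC mulrCA; congr (_ * _).
  have -> : v ^+ N = v ^+ (N - i) * v ^+ i by rewrite -exprD subnK // ltnW.
  by rewrite -mulrA [_ ^+ i * _]mulrC vpow_expVr mulr1.
have {Ep}: eval_int v rp = eval_int v ('X^(N.+2) * p).
  rewrite Erp rmorphM rmorphXn /= eval_intX !exprS.
  have -> : eval_int vi p = v * (vi * eval_int vi p).
    by rewrite mulrA [v * _]mulrC vpow_mulVr mul1r.
  by rewrite Ep mulrA [v ^+ N * _]mulrC -!mulrA; congr (_ * _); rewrite mulrCA.
move/(congr1 lval); rewrite !lval_eval_int => /eqP.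
rewrite /ratfun_of tofrac_eq => /eqP Ep.
apply/polyP => i; rewrite coef0.
(* This coefficient is [p_i] on the right, and zero on the left because [N + 2 + i] exceeds the
   degree of [rp]. *)
have := congr1 (fun f : {poly int} => f`_(N.+2 + i)) Ep.
rewrite coefXnM ltnNge leq_addr addKn /= => <-.
rewrite coef_sum big1 // => j _; rewrite coefZ coefXn gtn_eqF ?mulr0 //.
by rewrite (leq_ltn_trans (leq_subr _ _)) // !addSn ltnS leqW // leq_addr.
Qed.

(** * Maps determined on generators, and compression between direct sums *)

Section Schur.
Variables (m n d : nat) (H : hecke_algebra d).
Local Notation composition := (composition m n d).
Local Notation Xi := (Xi m n d).

Lemma xy_module_out (P : {set composition}) (x : xy_module H P) la :
  la \notin P -> x la = 0.
Proof. by case: x => x /= /asboolP /(_ la) + /negPf laP; rewrite laP. Qed.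

(** The elements [[xy]_la] with [la] in [P] generate the direct sum over [H]. *)
Lemma schur_eq_gen (P : {set composition}) (f g : schur H P) :
  (forall la x, la \in P -> val x = at_comp la (xy H la) -> f x = g x) -> f = g.
Proof.
move=> fg; apply: schur_ext => x.
(* Setting the generator to zero outside [P] allows the sum below to run over all compositions. *)
have gen_proof la :
    (if la \in P then at_comp la (xy H la) else 0) \in xy_pred P.
  case: ifP => laP; last by rewrite rpred0.
  apply/asboolP => ka; rewrite ffunE; case: eqP => [->|_].
    by rewrite laP; exists 1; rewrite mulr1.
  by case: ifP => // _; exists 0; rewrite mulr0.
pose gen la : xy_module H P := XyModule (gen_proof la).
have /choice [h xh] : forall la, exists h, x la = gen la la * h.
  move=> la; case laP: (la \in P); last first.
    by exists 0; rewrite mulr0 xy_module_out ?laP.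
  have /asboolP/(_ la) := valP x; rewrite laP => -[h ->].
  by exists h; rewrite /= laP ffunE eqxx.
have -> : x = \sum_la (h la : H^c) *: gen la.
  apply/val_inj/ffunP => ka; rewrite raddf_sum sum_ffunE (bigD1 ka) //=.
  rewrite ffunE big1 ?addr0 // => la /negPf la_ka; rewrite ffunE /=.
  by case: ifP => _; rewrite ffunE ?[ka == _]eq_sym ?la_ka mul0r.
rewrite !linear_sum; apply: eq_bigr => la _; rewrite !linearZ; congr (_ *: _).
case laP: (la \in P); first by apply: (fg la); rewrite //= laP.
suff -> : gen la = 0 by rewrite !linear0.
by apply: val_inj; rewrite /= laP.
Qed.

Lemma xy_trunc_at (P Q : {set composition}) (x : xy_module H P) la h :
  val x = at_comp la h -> la \in Q -> val (xy_trunc Q x) = at_comp la h.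
Proof.
move=> xE laQ; apply/ffunP => ka; rewrite ffunE -[xy_val x]/(val x) xE ffunE.
by case: eqP => [->|_]; rewrite ?laQ ?if_same.
Qed.

Lemma xy_truncK_at (P Q : {set composition}) (x : xy_module H P) la h :
  val x = at_comp la h -> la \in Q -> xy_trunc P (xy_trunc Q x) = x.
Proof.
move=> xE laQ; apply/val_inj/ffunP => ka.
have xQ : (if ka \in Q then x ka else 0) = x ka.
  rewrite -[xy_val x]/(val x) xE ffunE.
  by case: eqP => [->|_]; rewrite ?laQ ?if_same.
by rewrite /= !ffunE xQ; case: ifPn => // kaP; rewrite xy_module_out.
Qed.

Section Compress.
(** For [Q] contained in [P], [compress Q] is [f |-> e f e], and [compress P] in
    the other direction is the extension by zero. *)
Variables P Q : {set composition}.

Definition compress (f : schur H P) : schur H Q :=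
  @xy_trunc m n d H P Q \o f \o @xy_trunc m n d H Q P.

Lemma compressE f x : compress f x = xy_trunc Q (f (xy_trunc P x)).
Proof. by []. Qed.

Lemma compress_linear : linear compress.
Proof.
move=> a f g; apply: schur_ext => x.
by rewrite [RHS]/= /schur_scale_fun !compressE linearP.
Qed.
HB.instance Definition _ :=
  GRing.isLinear.Build laurent (schur H P) (schur H Q) *:%R compress compress_linear.

(** No inclusion between [P] and [Q] is assumed, so this covers both cutting down and extending by
    zero. *)
Lemma is_std_map_compress A f :
  A \in Xi_on Q -> is_std_map A f -> is_std_map A (compress f).
Proof.
rewrite inE => /andP[rowQ colQ] [f0 [x xE fx]]; split.
  move=> la y la_nu y0; rewrite compressE (f0 la) ?linear0 // => ka ka_la.
  by rewrite ffunE y0 ?if_same.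
exists (xy_trunc Q x); first exact: xy_trunc_at xE colQ.
by rewrite compressE (xy_truncK_at xE colQ) (xy_trunc_at fx).
Qed.

(** If [col A] is outside [Q], the source summand is cut off; if [row A] is, the image is truncated
    to zero. *)
Lemma compress_std_out A f :
  A \notin Xi_on Q -> is_std_map A f -> compress f = 0.
Proof.
rewrite inE negb_and => AQ [f0 [x xE fx]].
apply: schur_eq_gen => la y laQ yE; rewrite compressE.
have [la_nu|la_nu] := eqVneq la (xi_col A); last first.
  rewrite (f0 la) ?linear0 // => ka /negPf ka_la.
  by rewrite ffunE -[xy_val y]/(val y) yE ffunE ka_la if_same.
rewrite la_nu in laQ yE; rewrite laQ orbF in AQ.
have -> : y = xy_trunc Q x by apply: val_inj; rewrite (xy_trunc_at xE).
rewrite (xy_truncK_at xE) //; apply/val_inj/ffunP => ka.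
rewrite !ffunE -[xy_val (f x)]/(val _) fx ffunE.
by case: eqP => [->|_]; rewrite ?(negPf AQ) ?if_same.
Qed.

Lemma is_schur_bar_compress (bar : {rmorphism H -> H}) f :
  Q \subset P -> is_schur_bar bar f f ->
  is_schur_bar bar (compress f) (compress f).
Proof.
move=> /subsetP QP fbar la laQ; have [x [y [xE yE fxy]]] := fbar la (QP _ laQ).
exists (xy_trunc Q x), (xy_trunc Q y); split; try exact: xy_trunc_at laQ.
move=> mu; rewrite !compressE (xy_truncK_at xE laQ).
rewrite (xy_truncK_at yE laQ) /= !ffunE.
by case: ifP => _; rewrite ?rmorph0 ?fxy.
Qed.

End Compress.

Lemma is_std_map_uniq (P : {set composition}) A (f g : schur H P) :
  is_std_map A f -> is_std_map A g -> f = g.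
Proof.
move=> [f0 [x xE fx]] [g0 [y yE gy]]; apply: schur_eq_gen => la z laP zE.
have [la_nu|la_nu] := eqVneq la (xi_col A); last first.
  have z0 ka : ka != la -> z ka = 0.
    by move=> /negPf ka_la; rewrite -[xy_val z]/(val z) zE ffunE ka_la.
  by rewrite (f0 la) ?(g0 la).
rewrite la_nu in zE; apply: val_inj.
have -> : z = x by apply: val_inj; rewrite zE.
by rewrite fx -gy; congr (val (g _)); apply: val_inj; rewrite xE.
Qed.

Lemma std_mapP (P : {set composition}) A :
  is_std_map A (std_map H P A) \/
  std_map H P A = 0 /\ forall f : schur H P, ~ is_std_map A f.
Proof.
rewrite /std_map; case: pselect => [ex|nex]; first by left; case: cid.
by right; split=> // f fA; apply: nex; exists f.
Qed.

(** For [A] labelled in both [P] and [Q], compression carries a map defining [e_A] either way, so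
    the default value zero of [std_map] occurs on both sides or on neither. *)
Lemma compress_std_map (P Q : {set composition}) A :
  A \in Xi_on P ->
  compress Q (std_map H P A) = if A \in Xi_on Q then std_map H Q A else 0.
Proof.
move=> AP; have [fA|[f0 nfA]] := std_mapP P A; last first.
  rewrite f0 linear0; case: ifP => // AQ.
  have [/(is_std_map_compress AP)/nfA []|[->]//] := std_mapP Q A.
case: ifPn => AQ; last exact: compress_std_out fA.
have {}fA := is_std_map_compress AQ fA.
have [gA|[_ /(_ _ fA)]//] := std_mapP Q A.
exact: is_std_map_uniq fA gA.
Qed.

Lemma compress_std_elt (P Q : {set composition}) A :
  A \in Xi_on P ->
  compress Q (std_elt H P A) = if A \in Xi_on Q then std_elt H Q A else 0.
Proof.
move=> AP; rewrite linearZ /= compress_std_map //.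
by case: ifP => _; rewrite ?scaler0.
Qed.

(** * Bar invariance and uniqueness of canonical bases *)

Lemma hecke_bar_eval (bar : {rmorphism H -> H}) p :
  is_hecke_bar bar -> bar (vi * eval_int vi p)%:A = (v * eval_int v p)%:A.
Proof.
have algM (a b : laurent) : (a * b)%:A = a%:A * b%:A :> H.
  exact: (rmorphM (in_alg H)).
have algDint (a : laurent) (c : int) : (a + c%:~R)%:A = a%:A + c%:~R :> H.
  by rewrite scalerDl; congr (_ + _); exact: (rmorph_int (in_alg H)).
move=> [barK barv _]; have barvi : bar vi%:A = v%:A by rewrite -barv barK.
rewrite !algM rmorphM barvi; congr (_ * _).
elim/poly_ind: p => [|p c IHp]; first by rewrite !rmorph0 !scale0r rmorph0.
by rewrite !eval_intMXaddC !algDint !algM rmorphD rmorphM IHp barvi rmorph_int.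
Qed.

Section Canonical.
Variables (P : {set composition}) (bar : {rmorphism H -> H}).

(** Scalars act by right multiplication, so a sum of maps is evaluated inside [H], where [bar] can
    be applied termwise. *)
Lemma schur_sumE (X : {set Xi}) (a : Xi -> laurent) (f : Xi -> schur H P) x mu :
  val ((\sum_(E in X) a E *: f E) x) mu = \sum_(E in X) val (f E x) mu * (a E)%:A.
Proof.
have -> : (\sum_(E in X) a E *: f E) x = \sum_(E in X) (a E *: f E) x.
  by apply: (big_morph (fun g : schur H P => g x)).
by rewrite raddf_sum sum_ffunE; apply: eq_bigr => E _; rewrite ffunE.
Qed.

Lemma canonical_basis_triangular (C : Xi -> schur H P) :
  is_canonical_basis bar C ->
  exists y : Xi -> Xi -> laurent,
    (forall A B, A \in Xi_on P -> y A B \in vinv_poly) /\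
    forall A, A \in Xi_on P -> C A = std_elt H P A +
      \sum_(B in Xi_on P | lt_alg B A) (vi * y A B) *: std_elt H P B.
Proof.
move=> [_ canC].
suff /choice [y yP] : forall A, exists y : Xi -> laurent, A \in Xi_on P ->
    (forall B, y B \in vinv_poly) /\ C A = std_elt H P A +
      \sum_(B in Xi_on P | lt_alg B A) (vi * y B) *: std_elt H P B.
  by exists y; split=> [A B|A] /yP[].
move=> A; case AP: (A \in Xi_on P); last by exists (fun=> 0).
have [_ [p pv CE]] := canC A AP.
have /choice [y yP] B : exists y, y \in vinv_poly /\ p B = vi * y.
  by have /in_vinvZvinvP [y yv pE] := pv B; exists y.
exists y => _; split=> [B|]; first by have [] := yP B.
by rewrite CE; congr (_ + _); apply: eq_bigr => B _; have [_ <-] := yP B.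
Qed.

Lemma canonical_basis_std (C : Xi -> schur H P) :
  is_canonical_basis bar C ->
  exists N : Xi -> Xi -> laurent, forall A, A \in Xi_on P ->
    (forall B, B \in Xi_on P -> N A B \in vinv_poly) /\
    std_elt H P A = \sum_(B in Xi_on P) N A B *: C B.
Proof.
move=> canC; have [y [yv CE]] := canonical_basis_triangular canC.
have [[span indep] _] := canC.
have /choice [N NE] A := span (std_elt H P A).
have Nrec A E : A \in Xi_on P -> E \in Xi_on P ->
    N A E = (A == E)%:R - \sum_(B in Xi_on P | lt_alg B A) vi * y A B * N B E.
  move=> AP EP; apply/eqP; rewrite -subr_eq0; apply/eqP.
  (* These are the coefficients in the basis [C] of [[A] - C_A + \sum_B v^{-1} y_AB [B]], which
     vanishes by triangularity. *)
  pose c E := N A E - ((A == E)%:R -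
    \sum_(B in Xi_on P | lt_alg B A) vi * y A B * N B E).
  apply: (indep c) => //.
  under eq_bigr do rewrite !scalerBl.
  rewrite !sumrB -NE (bigD1 A) //= eqxx scale1r big1 ?addr0; last first.
    by move=> B /andP[_ /negPf BA]; rewrite eq_sym BA scale0r.
  rewrite CE // opprB addrA addrAC opprD addrA subrr add0r.
  under eq_bigr do rewrite scaler_suml.
  rewrite exchange_big /= addrC -sumrB big1 // => B _.
  by rewrite NE scaler_sumr -sumrB big1 // => F _; rewrite scalerA subrr.
have [k Nk] := vinv_poly_bounds (fun AE : Xi * Xi => N AE.1 AE.2).
exists N => A AP; split=> [E EP|]; last exact: NE.
suff {A AP E EP} Ndesc l : forall A E, A \in Xi_on P -> E \in Xi_on P ->
    vi ^+ (k - l) * N A E \in vinv_poly.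
  by have := Ndesc k A E AP EP; rewrite subnn mul1r.
(* [v^{-(k-l-1)} N = v^{-(k-l-1)} - y v^{-(k-l)} N] *)
elim: l => [|l IHl] A E AP EP; first by rewrite subn0 (Nk (A, E)).
(* Subtraction is truncated: once [k <= l], both exponents are zero. *)
have [kl|lk] := leqP k l.
  have := IHl A E AP EP; move: (kl) (leqW kl); rewrite -!subn_eq0.
  by move=> /eqP-> /eqP->.
rewrite Nrec // mulrBr rpredB //; first by rewrite rpredM ?rpredX ?vinv_polyV ?rpred_nat.
rewrite mulr_sumr rpred_sum // => B /andP[BP _].
have -> : vi ^+ (k - l.+1) * (vi * y A B * N B E) = y A B * (vi ^+ (k - l) * N B E).
  rewrite -(subnSK lk) exprSr -!mulrA [RHS]mulrCA; congr (_ * _).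
  by rewrite [RHS]mulrCA.
by rewrite rpredM ?yv ?IHl.
Qed.

Lemma canonical_basis_uniq (C D : Xi -> schur H P) :
  is_hecke_bar bar -> is_canonical_basis bar C -> is_canonical_basis bar D ->
  forall A, A \in Xi_on P -> D A = C A.
Proof.
move=> hbar canC canD A AP; apply/eqP; rewrite -subr_eq0; apply/eqP.
have [yC [yCv CE]] := canonical_basis_triangular canC.
have [yD [yDv DE]] := canonical_basis_triangular canD.
have [N NP] := canonical_basis_std canC.
have [[_ indep] barC] := canC; have [_ barD] := canD.
(* [v^{-1} z E] is the coefficient of [C E] in [D A - C A], found by expanding each [[B]] in the
   basis [C]. *)
pose z E := \sum_(B in Xi_on P | lt_alg B A) (yD A B - yC A B) * N B E.
have /choice [s sP] E : exists s, E \in Xi_on P -> z E = eval_int vi s.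
  case EP: (E \in Xi_on P); last by exists 0.
  suff /asboolP [s sE] : z E \in vinv_poly by exists s.
  rewrite rpred_sum // => B /andP[BP _].
  by rewrite rpredM ?rpredB ?yDv ?yCv //; have [-> ] := NP B BP.
have GE : D A - C A = \sum_(E in Xi_on P) (vi * z E) *: C E.
  rewrite CE // DE // opprD addrACA subrr add0r -sumrB.
  under [RHS]eq_bigr do rewrite /z mulr_sumr scaler_suml.
  rewrite exchange_big /=; apply: eq_bigr => B /andP[BP _].
  rewrite -scalerBl -mulrBr; have [_ ->] := NP B BP.
  by rewrite scaler_sumr; apply: eq_bigr => E _; rewrite scalerA mulrA.
(* Barring the expansion [GE]: all maps involved are bar invariant, so only the scalars change, by
   [v |-> v^{-1}]. *)
have GE' : D A - C A = \sum_(E in Xi_on P) (v * eval_int v (s E)) *: C E.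
  apply: schur_eq_gen => la x laP xE; apply/val_inj/ffunP => mu.
  have [barCA _] := barC A AP; have [_ [y [_ yE _]]] := barCA la laP.
  (* Each invariance statement brings its own witnesses for [[xy]_la] and its bar; they are
     identified by their values. *)
  have fix_bar f : is_schur_bar bar f f -> val (f x) mu = bar (val (f y) mu).
    move=> /(_ la laP) [x' [y' [x'E y'E fx']]].
    have -> : x = x' by apply: val_inj; rewrite x'E.
    by rewrite fx'; congr (bar (val (f _) mu)); apply: val_inj; rewrite y'E yE.
  rewrite schur_sumE.
  have -> : val ((D A - C A) x) mu = bar (val ((D A - C A) y) mu).
    have valB w : val ((D A - C A) w) mu = val (D A w) mu - val (C A w) mu.
      by rewrite /= !ffunE.
    by rewrite !valB rmorphB !fix_bar //; have [] := barD A AP.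
  rewrite GE schur_sumE rmorph_sum; apply: eq_bigr => E EP.
  rewrite rmorphM sP // hecke_bar_eval // fix_bar //.
  by have [] := barC E EP.
have zs E : E \in Xi_on P -> vi * z E - v * eval_int v (s E) = 0.
  pose c E := vi * z E - v * eval_int v (s E).
  apply: (indep c); under eq_bigr do rewrite scalerBl.
  by rewrite sumrB -GE -GE' subrr.
rewrite GE big1 // => E EP; have /eqP := zs E EP.
rewrite subr_eq0 sP // => /eqP/eval_int_bar_fixed ->.
by rewrite rmorph0 mulr0 scale0r.
Qed.

End Canonical.

(** * Transfer of a canonical basis to a smaller direct sum *)

Lemma Xi_on_sub (P Q : {set composition}) : Q \subset P -> Xi_on Q \subset Xi_on P.
Proof.
move=> /subsetP QP; apply/subsetP => A; rewrite !inE => /andP[rA cA].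
by rewrite !QP.
Qed.

Lemma lt_alg_Xi_on (P : {set composition}) (A B : Xi) :
  lt_alg B A -> (B \in Xi_on P) = (A \in Xi_on P).
Proof. by rewrite !inE => /andP[/and3P[/eqP-> /eqP-> _] _]. Qed.

(** [lt_alg] preserves [row] and [col], so all terms of [C A] survive or die together with [[A]].
    The first claim says that compressing a surviving [C A] loses nothing. *)
Lemma compress_canonical (P Q : {set composition}) (bar : {rmorphism H -> H})
    (C : Xi -> schur H P) :
  Q \subset P -> is_canonical_basis bar C ->
  (forall A, A \in Xi_on Q -> compress P (compress Q (C A)) = C A) /\
  is_canonical_basis bar (fun A => compress Q (C A)).
Proof.
move=> QP [[span indep] canC]; have /subsetP XQP := Xi_on_sub QP.
have CQ A (AP : A \in Xi_on P) : exists2 p : Xi -> laurent,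
    forall B, in_vinvZvinv (p B) &
    C A = std_elt H P A + \sum_(B in Xi_on P | lt_alg B A) p B *: std_elt H P B.
  by have [] := canC A AP.
have compressC A (p : Xi -> laurent) : A \in Xi_on Q ->
    compress Q (std_elt H P A + \sum_(B in Xi_on P | lt_alg B A) p B *: std_elt H P B) =
    std_elt H Q A + \sum_(B in Xi_on Q | lt_alg B A) p B *: std_elt H Q B.
  move=> AQ; rewrite linearD linear_sum /= compress_std_elt ?XQP // AQ.
  congr (_ + _); apply: eq_big => [B|B /andP[BP BA]].
    by apply: andb_id2r => BA; rewrite !(lt_alg_Xi_on _ BA) AQ XQP.
  by rewrite linearZ /= compress_std_elt // (lt_alg_Xi_on _ BA) AQ.
have compressK A : A \in Xi_on Q -> compress P (compress Q (C A)) = C A.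
  move=> AQ; have AP := XQP A AQ; have [p _ ->] := CQ A AP.
  rewrite compressC // linearD linear_sum /= compress_std_elt // AP.
  congr (_ + _); apply: eq_big => [B|B /andP[BQ BA]].
    by apply: andb_id2r => BA; rewrite !(lt_alg_Xi_on _ BA) AQ AP.
  by rewrite linearZ /= compress_std_elt // XQP.
have compress0 A : A \in Xi_on P -> A \notin Xi_on Q -> compress Q (C A) = 0.
  move=> AP AQ; have [p _ ->] := CQ A AP.
  rewrite linearD linear_sum /= compress_std_elt // (negPf AQ) add0r.
  rewrite big1 // => B /andP[BP BA].
  by rewrite linearZ /= compress_std_elt // (lt_alg_Xi_on _ BA) (negPf AQ) scaler0.
split=> //; split; [split|].
- move=> f; have [c fE] := span (compress P f); exists c.
  (* Extending by zero and cutting back is the identity, so expanding the extension of [f] in [C]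
     and compressing gives spanning. *)
  have -> : f = compress Q (compress P f).
    apply: schur_eq_gen => la x laQ xE; rewrite !compressE.
    have laP : la \in P by apply: (subsetP QP).
    rewrite (xy_truncK_at xE) //; apply/val_inj/ffunP => ka.
    rewrite !ffunE; case: ifPn => kaQ; first by rewrite (subsetP QP).
    by rewrite xy_module_out.
  rewrite fE linear_sum /= (big_setID (Xi_on Q)) /=.
  rewrite (setIidPr (Xi_on_sub QP)) [X in _ + X]big1 ?addr0; last first.
    by move=> A /setDP[AP AQ]; rewrite linearZ /= compress0 // scaler0.
  by apply: eq_bigr => A _; rewrite linearZ.
- move=> c c0 A AQ; pose c' B := if B \in Xi_on Q then c B else 0.
  suff: c' A = 0 by rewrite /c' AQ.
  apply: indep (XQP A AQ).
  rewrite (big_setID (Xi_on Q)) /= (setIidPr (Xi_on_sub QP)).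
  rewrite [X in _ + X]big1 ?addr0; last first.
    by move=> B /setDP[_ BQ]; rewrite /c' (negPf BQ) scale0r.
  (* Extension by zero turns the given relation into one among the [C B], with [c] extended by zero
     as [c']. *)
  rewrite -[RHS](linear0 (compress (P := Q) P)) -c0 linear_sum /=.
  by apply: eq_bigr => B BQ; rewrite linearZ /= compressK // /c' BQ.
- move=> A AQ; have [barCA _] := canC A (XQP A AQ).
  split; first exact: is_schur_bar_compress.
  have [p pv CE] := CQ A (XQP A AQ); exists p => //.
  by rewrite {1}CE compressC.
Qed.

End Schur.

Theorem theorem6p4 (d m n : nat) (hd : (1 <= d)%N) (H : hecke_algebra d)
    (bar : {rmorphism H -> H}) (hbar : is_hecke_bar bar)
    (C : Xi m n d -> schur H (all_compositions m n d))
    (hC : is_canonical_basis bar C) :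
  exists Ci : Xi m n d -> schur H (icompositions m n d),
    [/\ forall A, A \in Xi_on (icompositions m n d) -> schur_incl (Ci A) = C A,
        is_canonical_basis bar Ci
      & forall D : Xi m n d -> schur H (icompositions m n d),
          is_canonical_basis bar D ->
          forall A, A \in Xi_on (icompositions m n d) -> D A = Ci A].
Proof.
(* Here [compress] back to all compositions is convertible to [schur_incl], so [inclC] is the first
   claim. *)
have [inclC canC] := compress_canonical (subsetT (icompositions m n d)) hC.
exists (fun A => compress (icompositions m n d) (C A)); split=> // D canD A AQ.
exact: (canonical_basis_uniq hbar canC canD AQ).
Qed.
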